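(* For integers $d,e>1$ and $w\ge 0$, the number of $d$-balanced $e$-regular partitions is the same in every block of $e$-weight $w$; in particular, it depends only on $d$, $e$ and $w$.
   Context: A partition $\lambda=(\lambda_1\ge\lambda_2\ge\dots\ge\lambda_\ell>0)$ has Young diagram $[\lambda]=\{(r,c):1\le r\le \ell,\ 1\le c\le\lambda_r\}$ and size $|\lambda|=\sum\lambda_j$; $\lambda'$ denotes the conjugate partition. It is $e$-regular if no part is repeated $e$ or more times. For $(r,c)\in[\lambda]$ the arm length of the hook at $(r,c)$ is $a_{rc}(\lambda)=\lambda_r-c$ and its hook length is $h_{rc}(\lambda)=a_{rc}(\lambda)+(\lambda'_c-r)+1$. The partition $\lambda$ is $d$-balanced (with respect to $e$) if $d\mid a_{rc}(\lambda)$ for every node $(r,c)\in[\lambda]$ with $e\mid h_{rc}(\lambda)$. The $\beta$-set of $\lambda$ is $B_0(\lambda)=\{\lambda_j-j: j\ge 1\}$ (with $\lambda_j=0$ for $j>\ell$). The $e$-core of $\lambda$ is the partition whose $\beta$-set is obtained from $B_0(\lambda)$ by repeatedly replacing an element $b$ by $b-e$ whenever $b-e$ is not in the set, until this is no longer possible (equivalently, by removing rim hooks of length $e$ until none remain). The $e$-weight of $\lambda$ is $(|\lambda|-|\gamma|)/e$, where $\gamma$ is the $e$-core of $\lambda$. A block is the set of all partitions with a given $e$-core $\gamma$ (a partition equal to its own $e$-core) and a given $e$-weight $w\geq 0$, called the $e$-core and $e$-weight of the block. *)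

(* Defs.v *)
From HB Require Import structures.
From mathcomp Require Import all_boot all_order all_algebra.
From mathcomp Require Import boolp classical_sets functions cardinality.
From Stdlib Require Import Relations.

Set Implicit Arguments.
Unset Strict Implicit.
Unset Printing Implicit Defensive.

Import GRing.Theory.

Record intpart : Type := Intpart {
  parts :> seq nat;
  _ : sorted geq parts && (0 \notin parts) }.

HB.instance Definition _ := [isSub for parts].
HB.instance Definition _ := [Choice of intpart by <:].

Definition psize (lam : intpart) : nat := sumn lam.

(* Rows, columns and indices of parts are numbered from 0: the node (r, c) here
   is the node (r + 1, c + 1) in the usual convention. *)
Definition part (lam : intpart) (j : nat) : nat := nth 0 lam j.

Definition conj_part (lam : intpart) (c : nat) : nat := count (fun p => c < p) lam.

Definition node (lam : intpart) (r c : nat) : bool := c < part lam r.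

(* The truncated subtractions are exact at the nodes of the diagram. *)
Definition arm (lam : intpart) (r c : nat) : nat := part lam r - c.+1.

Definition leg (lam : intpart) (r c : nat) : nat := conj_part lam c - r.+1.

Definition hook (lam : intpart) (r c : nat) : nat := arm lam r c + leg lam r c + 1.

Definition regular (e : nat) (lam : intpart) : Prop :=
  forall p : nat, p \in parts lam -> count_mem p lam < e.

Definition balanced (d e : nat) (lam : intpart) : Prop :=
  forall r c : nat, node lam r c -> e %| hook lam r c -> d %| arm lam r c.

Local Open Scope classical_set_scope.

Definition beta_set (lam : intpart) : set int :=
  [set ((part lam j)%:Z - j.+1%:Z)%R | j in [set: nat]].

Definition bead_move (e : nat) (B B' : set int) : Prop :=
  exists b : int, [/\ B b, ~ B (b - e%:Z)%R &
    B' = (B `\ b) `|` [set (b - e%:Z)%R]].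

(* gam is the e-core of lam: its beta-set is reached from that of lam by
   finitely many moves, and no further move is possible. *)
Definition is_core_of (e : nat) (gam lam : intpart) : Prop :=
  clos_refl_trans (set int) (bead_move e) (beta_set lam) (beta_set gam) /\
  ~ (exists B' : set int, bead_move e (beta_set gam) B').

Definition is_core (e : nat) (gam : intpart) : Prop := is_core_of e gam gam.

(* The second condition is (|lam| - |gam|) / e = w, without division. *)
Definition block (e : nat) (gam : intpart) (w : nat) : set intpart :=
  [set lam | is_core_of e gam lam /\ psize lam = psize gam + e * w].

(* Main.v *)
Require Import Defs.
From Stdlib Require Import Relations.
From mathcomp Require Import boolp classical_sets functions cardinality.
From mathcomp Require Import all_boot all_order all_algebra zify.

(** Encode a partition by the beads of its [beta]-set on an abacus, shifted to
the natural numbers.  Counting the gaps before each position, [lam] is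
[e]-regular and [d]-balanced iff every bead [b] and earlier gap [g] on the same
runner satisfy [gaps b = gaps g + 1] modulo [d] and [gaps b > gaps g + 1].

Compare two blocks whose cores differ by exchanging the contents of runners 0
and 1.  Call a row mixed when exactly one of its positions on these runners
holds a bead; exchanging the two positions of a mixed row does not change the
number of gaps before any row.  Hence, once everything outside the mixed rows
is fixed, the condition only says that [allow t u] holds for all mixed rows [t]
with a left bead and [u] with a right bead.  As [allow] is antisymmetric, there
is at most one admissible choice of left beads of each cardinality; and if one
admissible choice is proper and nonempty, rows can be added to or removed from
it one at a time, so there is one of each cardinality.  Complementing the
number of left beads is therefore a bijection between the two blocks.  Shifting
the abacus so that a removable node of a nonempty core lies on runner 1 gives a
smaller core, so all blocks of weight [w] compare to that of the empty core. *)

Set Implicit Arguments.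
Unset Strict Implicit.
Unset Printing Implicit Defensive.

(** * Admissible sets of left beads *)

Section Tournament.
Variables (d T : nat) (g : 'I_T -> nat) (M : {set 'I_T}).
Hypothesis g_lt : forall t u : 'I_T, t \in M -> t < u -> g t < g u.

(** With [n] and [m] the gap counts at a bead and at an earlier gap, [n - m - 1] is an arm length;
    it has to be positive and divisible by [d]. *)
Definition succ_mod (d n m : nat) : Prop := n = m.+1 %[mod d] /\ m.+1 < n.

(** Here [g] counts the gaps before a row, [t] has a left bead and [u] a right one. If [t < u], the
    right bead of [u] is tested against the right gap of [t], with counts [g u + 1] and [g t], and
    [g_lt] gives the inequality. Otherwise the left bead of [t] is tested against the left gap of
    [u]. *)
Definition allow (t u : 'I_T) : Prop :=
  if t < u then g t = g u %[mod d] else succ_mod d (g t) (g u).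

Definition splits (S : {set 'I_T}) : Prop :=
  S \subset M /\ forall t u, t \in S -> u \in M -> u \notin S -> allow t u.

Lemma modS_neq (n : nat) : 1 < d -> n <> n.+1 %[mod d].
Proof.
move=> d1 /eqP h; move: h; have := eqn_modDl n 0 1 d.
by rewrite addn0 addn1 mod0n (modn_small d1) => ->.
Qed.

Lemma modS_eq (n m : nat) : n.+1 = m.+1 %[mod d] <-> n = m %[mod d].
Proof.
by rewrite -(add1n n) -(add1n m); split=> /eqP h; apply/eqP; move: h;
   rewrite eqn_modDl.
Qed.

(** Otherwise some [t] lies only in [S] and some [u] only in [S']. Then [allow t u] and [allow u t]
    both hold, which makes a number congruent to its successor modulo [d]. *)
Lemma splits_inj (S S' : {set 'I_T}) :
  1 < d -> splits S -> splits S' -> #|S| = #|S'| -> S = S'.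
Proof.
move=> d1 [SM hS] [SM' hS'] cSS'.
apply/eqP; rewrite eqEcard cSS' leqnn andbT; apply/subsetP => t tS.
apply/negPn/negP => tS'.
have /subsetPn[u uS' uS] : ~~ (S' \subset S).
  apply/negP => /subset_leqif_cards /leqifP.
  by case: eqP => [E|_]; [rewrite E tS in tS' | rewrite cSS' ltnn].
have := hS _ _ tS (subsetP SM' _ uS') uS.
have := hS' _ _ uS' (subsetP SM _ tS) tS'.
rewrite /allow; case: (ltngtP t u) => [_ [h _] h'|_ h [h' _]|/val_inj E].
- by apply: (@modS_neq (g t)) => //; rewrite {1}h' h.
- by apply: (@modS_neq (g u)) => //; rewrite {1}h h'.
by rewrite E uS' in tS'.
Qed.

Lemma splits_add (S : {set 'I_T}) (r : 'I_T) :
  splits S -> r \in M -> r \notin S ->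
  (forall u, u \in M -> u \notin S -> u != r -> allow r u) -> splits (r |: S).
Proof.
move=> [SM hS] rM rS hr; split; first by rewrite subUset sub1set rM.
move=> t u; rewrite !inE negb_or => /orP[/eqP ->|tS] uM /andP[ur uS]; first exact: hr.
exact: hS.
Qed.

Lemma splits_del (S : {set 'I_T}) (s : 'I_T) :
  splits S -> s \in S ->
  (forall t, t \in S -> t != s -> allow t s) -> splits (S :\ s).
Proof.
move=> [SM hS] sS hs; split; first by apply: subset_trans SM; apply: subD1set.
move=> t u; rewrite !inE => /andP[ts tS] uM; rewrite negb_and negbK.
by case: eqP => [->|_] /= us; [apply: hs | apply: hS].
Qed.

(** Fix [t] in [S]. The row to add is the least row of [M] outside [S] above [t], or failing that
    the least one outside [S]; comparing [t] with it and with [u] settles how the two compare. *)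
Lemma splits_grow (S : {set 'I_T}) :
  splits S -> 0 < #|S| < #|M| -> exists2 S', splits S' & #|S'| = #|S|.+1.
Proof.
move=> spS /andP[/card_gt0P[t tS] cS]; have [SM hS] := spS.
have tM := subsetP SM _ tS.
suff [r [rM rS hr]] : exists r, [/\ r \in M, r \notin S &
    forall u, u \in M -> u \notin S -> u != r -> allow r u].
  by exists (r |: S); [apply: splits_add | rewrite cardsU1 rS].
have [|noU] := boolP [exists u, [&& u \in M, u \notin S & t < u]].
  case/existsP => u0 u0P.
  case: (@arg_minnP _ u0 [pred u | [&& u \in M, u \notin S & t < u]] val u0P)
    => r /and3P[rM rS tr] rmin.
  exists r; split=> // u uM uS ur.
  have := hS _ _ tS rM rS; have := hS _ _ tS uM uS; rewrite /allow tr.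
  case: (ltnP t u) => [tu hu hr|ut [hu lu] hr].
    have /= := rmin u; rewrite uM uS tu => /(_ isT).
    by rewrite leq_eqVlt val_eqE eq_sym (negPf ur) /= => ->; rewrite -hr.
  (* Here [u] is below [t], and [r] inherits its condition from [t]: [g r] is congruent to [g t] and
     larger. *)
  rewrite ltnNge (leq_trans ut (ltnW tr)) /=; split; first by rewrite -hr.
  by apply: leq_trans lu _; apply: ltnW; apply: g_lt.
have /subsetPn[u0 u0M u0S] : ~~ (M \subset S).
  by apply/negP => /subset_leq_card; rewrite leqNgt cS.
have u0P : (u0 \in M) && (u0 \notin S) by rewrite u0M.
case: (@arg_minnP _ u0 [pred u | (u \in M) && (u \notin S)] val u0P)
  => r /andP[rM rS] rmin.
exists r; split=> // u uM uS ur.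
have below v : v \in M -> v \notin S -> t < v = false.
  by move=> vM vS; apply: contraNF noU => tv; apply/existsP; exists v; rewrite vM vS.
(* All rows outside [S] now lie below [t], so their counts are congruent to one another. *)
have := hS _ _ tS rM rS; have := hS _ _ tS uM uS; rewrite /allow !below //.
have /= := rmin u; rewrite uM uS => /(_ isT).
rewrite leq_eqVlt val_eqE eq_sym (negPf ur) /= => -> [hu _] [hr _].
by apply/modS_eq; rewrite -hr hu.
Qed.

(** The mirror image of [splits_grow]: with [u] fixed in [M] outside [S], the row to remove is the
    greatest row of [S] below [u], or failing that the greatest row of [S]. *)
Lemma splits_shrink (S : {set 'I_T}) :
  splits S -> 0 < #|S| < #|M| -> exists2 S', splits S' & #|S'| = #|S|.-1.
Proof.
move=> spS /andP[/card_gt0P[s0 s0S] cS]; have [SM hS] := spS.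
have /subsetPn[u uM uS] : ~~ (M \subset S).
  by apply/negP => /subset_leq_card; rewrite leqNgt cS.
suff [s sS hs] : exists2 s, s \in S & forall t, t \in S -> t != s -> allow t s.
  by exists (S :\ s); [apply: splits_del | rewrite [#|S|](cardsD1 s) sS].
have [|noU] := boolP [exists t, (t \in S) && (t < u)].
  case/existsP => t0 t0P.
  case: (@arg_maxnP _ t0 [pred t | (t \in S) && (t < u)] val t0P) => s /andP[sS su] smax.
  exists s => // t tS ts.
  have := hS _ _ sS uM uS; have := hS _ _ tS uM uS; rewrite /allow su.
  case: (ltnP t u) => [tu ht hs|ut [ht lt] hs].
    have /= := smax t; rewrite tS tu => /(_ isT).
    by rewrite leq_eqVlt val_eqE (negPf ts) /= => ->; rewrite ht hs.
  rewrite ltnNge (leq_trans (ltnW su) ut) /=; split.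
    by rewrite ht; apply/modS_eq.
  by apply: leq_ltn_trans lt; apply: ltnW; apply: g_lt => //; apply: (subsetP SM).
case: (@arg_maxnP _ s0 (mem S) val s0S) => s sS smax.
exists s => // t tS ts.
have above v : v \in S -> v < u = false.
  by move=> vS; apply: contraNF noU => vu; apply/existsP; exists v; rewrite vS.
have := hS _ _ sS uM uS; have := hS _ _ tS uM uS; rewrite /allow !above //.
have /= := smax t tS; rewrite leq_eqVlt val_eqE (negPf ts) /= => ->.
by move=> [ht _] [hs _]; rewrite ht hs.
Qed.

(** The sizes 0 and [#|M|] are attained by [set0] and [M]. For [k] strictly between, steps of size
    one towards [k] never leave the range where growing and shrinking are possible. *)
Lemma splits_card (S : {set 'I_T}) (k : nat) :
  splits S -> 0 < #|S| < #|M| -> k <= #|M| -> exists2 S', splits S' & #|S'| = k.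
Proof.
move=> spS cS kM; have [m Em] := ubnP (#|S| - k + (k - #|S|)).
elim: m S spS cS Em => // m IHm S spS cS Em.
have [k0|k_gt0] := posnP k.
  exists set0; last by rewrite cards0 k0.
  by split; [apply: sub0set | move=> t u; rewrite inE].
have [kT|kT] := eqVneq k #|M|.
  by exists M; [split => // t u _ ->|].
case: (ltngtP k #|S|) => [lk|gk|->]; last by exists S.
  by have [S' spS' cS'] := splits_shrink spS cS; apply: (IHm S' spS'); lia.
by have [S' spS' cS'] := splits_grow spS cS; apply: (IHm S' spS'); lia.
Qed.

Lemma splits_compl (S : {set 'I_T}) :
  splits S -> exists2 S', splits S' & #|S'| = #|M| - #|S|.
Proof.
move=> spS; have SM : #|S| <= #|M| by apply: subset_leq_card; case: spS.
have [S0|S_gt0] := posnP #|S|.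
  by exists M; [split=> // t u _ -> | rewrite S0 subn0].
have [SltM|SgeM] := ltnP #|S| #|M|.
  by apply: (splits_card spS); rewrite ?S_gt0 ?leq_subr.
exists set0; first by split; [apply: sub0set | move=> t u; rewrite inE].
by rewrite cards0; apply/esym/eqP.
Qed.

End Tournament.

(** * The abacus *)

Definition gaps (X : nat -> bool) (x : nat) : nat := \sum_(y < x) ~~ X y.

Lemma gapsS (X : nat -> bool) (x : nat) : gaps X x.+1 = gaps X x + ~~ X x.
Proof. by rewrite /gaps big_ord_recr. Qed.

Lemma leq_gaps (X : nat -> bool) (x y : nat) : x <= y -> gaps X x <= gaps X y.
Proof.
move=> /subnKC <-; elim: (y - x) => [|k IHk]; first by rewrite addn0.
by rewrite addnS gapsS (leq_trans IHk) ?leq_addr.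
Qed.

Lemma ltn_gaps (X : nat -> bool) (x y : nat) :
  ~~ X x -> x < y -> gaps X x < gaps X y.
Proof. by move=> Xx /(leq_gaps X); rewrite gapsS Xx addn1. Qed.

Definition good (d e : nat) (X : nat -> bool) : Prop :=
  forall b g, X b -> ~~ X g -> g < b -> g = b %[mod e] ->
    succ_mod d (gaps X b) (gaps X g).

(** Equal numbers of beads in each row force equal full rows, empty rows and mixed rows; only the
    side of the bead in a mixed row is free. *)
Definition same_frame (e : nat) (X Y : nat -> bool) : Prop :=
  (forall x, 1 < x %% e -> X x = Y x) /\
  forall t, X (t * e) + X (t * e).+1 = Y (t * e) + Y (t * e).+1.

Definition runner_count (e P r : nat) (X : nat -> bool) : nat :=
  \sum_(x < P) X x * (x %% e == r).

Lemma sum_runners (T e : nat) (f : nat -> nat) :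
  \sum_(x < T * e) f x = \sum_(t < T) \sum_(s < e) f (t * e + s).
Proof.
elim: T => [|T IHT]; first by rewrite mul0n !big_ord0.
by rewrite mulSn addnC big_split_ord /= IHT big_ord_recr.
Qed.

Lemma runner_countE (T e r : nat) (X : nat -> bool) :
  r < e -> runner_count e (T * e) r X = \sum_(t < T) X (t * e + r).
Proof.
move=> re; rewrite /runner_count (sum_runners T e (fun x => X x * (x %% e == r))).
apply: eq_bigr => t _; rewrite (bigD1 (Ordinal re)) //= big1 => [|s sr].
  by rewrite modnMDl modn_small // eqxx muln1 addn0.
rewrite modnMDl modn_small //; case: eqP => [E|_]; last by rewrite muln0.
by case/eqP: sr; apply: val_inj.
Qed.

(** * Configurations with a common frame *)

Section Frame.
Variables (d e : nat).
Hypothesis e_gt1 : 1 < e.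

Lemma same_frame_sym (X Y : nat -> bool) : same_frame e X Y -> same_frame e Y X.
Proof. by case=> h1 h2; split=> [x /h1 ->|t]; rewrite ?h2. Qed.

Lemma same_frame_trans (X Y Z : nat -> bool) :
  same_frame e X Y -> same_frame e Y Z -> same_frame e X Z.
Proof.
by move=> [h1 h2] [k1 k2]; split=> [x xe|t]; [rewrite h1 ?k1 | rewrite h2 k2].
Qed.

(** Only a count stopped between the two positions of a row, that is at a position of runner 1, can
    tell [X] from [Y]. *)
Lemma gaps_frame (X Y : nat -> bool) (x : nat) :
  same_frame e X Y -> x %% e != 1 -> gaps X x = gaps Y x.
Proof.
move=> [h1 h2]; have [n] := ubnP x; elim: n x => // n IHn [|x] xn x1.
  by rewrite /gaps !big_ord0.
have [/eqP x_mod|x_mod] := boolP (x %% e == 1).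
  (* Just after such a pair, the induction goes back two positions at once, to the start of the
     row. *)
  have Ex : x = (x %/ e * e).+1 by rewrite {1}(divn_eq x e) x_mod addn1.
  move: (x %/ e) Ex => q Ex; subst x; rewrite !gapsS (IHn (q * e)) ?modnMl //.
    have := h2 q; case: (X (q * e)); case: (X (q * e).+1);
    by case: (Y (q * e)); case: (Y (q * e).+1) => //=; lia.
  by rewrite -ltnS (leq_trans _ xn) // ltnW.
rewrite !gapsS IHn //.
rewrite h1 //; case x_mod': (x %% e) => [|[|//]] in x_mod *; last by [].
by move: x1; rewrite -addn1 -modnDml x_mod' modn_small.
Qed.

(* Row t consists of the positions t * e and (t * e).+1. *)
Definition good_rows (X : nat -> bool) (t u : nat) : Prop :=
  let n := gaps X (u * e) in let m := gaps X (t * e) in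
  (X (u * e) -> ~~ X (t * e) -> succ_mod d n m) /\
  (X (u * e).+1 -> ~~ X (t * e).+1 ->
     succ_mod d (n + ~~ X (u * e)) (m + ~~ X (t * e))).

(** Separates the runners from 2 on, whose conditions depend only on the frame, from runners 0 and
    1, whose conditions are indexed by pairs of rows. *)
Lemma good_rowsP (X : nat -> bool) : good d e X <->
  (forall b g, X b -> ~~ X g -> g < b -> g = b %[mod e] -> 1 < b %% e ->
     succ_mod d (gaps X b) (gaps X g)) /\
  (forall t u, t < u -> good_rows X t u).
Proof.
have e0 : 0 < e by apply: ltnW.
split=> [gX|[gX1 gX2] b g Xb Xg gb gbe].
  split=> [b g *|t u tu]; first exact: gX.
  rewrite /good_rows -!gapsS; split=> Xb Xg; apply: gX; rewrite // ?modnMl //.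
  - by rewrite ltn_mul2r e0.
  - by rewrite ltnS ltn_mul2r e0.
  by rewrite -addn1 -[(u * e).+1]addn1 !modnMDl.
have [b2|b2] := ltnP 1 (b %% e); first exact: gX1.
have Eb := divn_eq b e; have Eg := divn_eq g e; rewrite gbe in Eg.
have tu : g %/ e < b %/ e by rewrite -(ltn_pmul2r e0); lia.
have [] := gX2 _ _ tu; case: (b %% e) b2 Eb Eg => [|[|//]] _.
  by rewrite !addn0 => <- <- h _; apply: h.
by rewrite !addn1 -!gapsS => <- <- _ h; apply: h.
Qed.

Lemma good_runners (X Y : nat -> bool) (b g : nat) :
  same_frame e X Y -> good d e X ->
  Y b -> ~~ Y g -> g < b -> g = b %[mod e] -> 1 < b %% e ->
  succ_mod d (gaps Y b) (gaps Y g).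
Proof.
move=> fXY gX Yb Yg gb gbe b2; have [fX _] := fXY.
have g2 : 1 < g %% e by rewrite gbe.
rewrite -!(gaps_frame fXY) ?gtn_eqF //.
by apply: gX => //; rewrite fX.
Qed.

Definition mixed (X : nat -> bool) (t : nat) : bool := X (t * e) != X (t * e).+1.

Lemma mixed_frame (X Y : nat -> bool) (t : nat) :
  same_frame e X Y -> mixed X t = mixed Y t.
Proof. case=> _ /(_ t); rewrite /mixed.
by case: (X (t * e)); case: (X _.+1); case: (Y (t * e)); case: (Y _.+1). Qed.

(** A mixed row contains a gap. This provides the hypothesis [g_lt] above. *)
Lemma gaps_mixed (X : nat -> bool) (t u : nat) :
  mixed X t -> t < u -> gaps X (t * e) < gaps X (u * e).
Proof.
move=> Xt tu; have : gaps X (t * e).+2 <= gaps X (u * e).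
  by apply: leq_gaps; have := leq_mul tu (leqnn e); rewrite mulSn; lia.
by move: Xt; rewrite !gapsS /mixed; do 2! case: (X _) => //=; lia.
Qed.

(** For mixed rows [t < u] this is [allow] in both orders; the left position of a mixed row
    determines the right one. *)
Definition allow_rows (X : nat -> bool) (t u : nat) : Prop :=
  (X (t * e) -> ~~ X (u * e) -> gaps X (t * e) = gaps X (u * e) %[mod d]) /\
  (X (u * e) -> ~~ X (t * e) -> succ_mod d (gaps X (u * e)) (gaps X (t * e))).

Lemma good_allow (X : nat -> bool) (t u : nat) : good d e X ->
  mixed X t -> mixed X u -> t < u -> allow_rows X t u.
Proof.
move=> /good_rowsP[_ gX] Xt Xu tu; have [] := gX _ _ tu.
move: Xt Xu; rewrite /mixed /allow_rows.
case: (X (t * e)); case: (X (t * e).+1) => //= _;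
case: (X (u * e)); case: (X (u * e).+1) => //= _; rewrite ?addn0 ?addn1 => h1 h2;
split=> // _ _; try exact: h1.
by have [/modS_eq -> _] := h2 isT isT.
Qed.

Lemma succ_modS (n m : nat) : succ_mod d n.+1 m.+1 <-> succ_mod d n m.
Proof.
by rewrite /succ_mod ltnS; split=> -[h l]; split=> //; [apply/modS_eq | apply/modS_eq].
Qed.

(** If one of two rows is full or empty, moving the bead of the other shifts both counts equally or
    not at all, so the condition passes from [X] to [Y]. *)
Lemma allow_good (X Y : nat -> bool) : same_frame e X Y -> good d e X ->
  (forall t u, mixed X t -> mixed X u -> t < u -> allow_rows Y t u) -> good d e Y.
Proof.
move=> fXY gX aY; apply/good_rowsP; split=> [b g *|t u tu].
  exact: (good_runners fXY gX).
have [gX1 gX2] := (proj1 (good_rowsP X) gX).2 _ _ tu.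
have := aY t u; rewrite /allow_rows /mixed /good_rows -!(gaps_frame fXY) ?modnMl //.
have := @gaps_mixed X t u; rewrite /mixed tu.
have [_ f] := fXY; have := f t; have := f u; move: gX1 gX2 {f}.
case: (X (t * e)); case: (X (t * e).+1); case: (Y (t * e)); case: (Y (t * e).+1) => //=;
case: (X (u * e)); case: (X (u * e).+1); case: (Y (u * e)); case: (Y (u * e).+1) => //=;
rewrite ?addn0 ?addn1 ?succ_modS => h1 h2 _ _ h3 h4.
all: split=> // _ _; try by [apply: h1 | apply: h2].
(* Only pairs of mixed rows remain. Left positions are covered by [allow_rows] directly; for right
   positions the congruence is shifted by one and the inequality comes from [gaps_mixed]. *)
all: try by case: (h4 isT isT isT) => h5 h6; apply: h6.
all: case: (h4 isT isT isT) => h5 h6; split; last by rewrite ltnS h3.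
all: by apply/modS_eq; rewrite h5.
Qed.
End Frame.

(** * Good configurations as splittings of the mixed rows *)

Section Rows.
Variables (d e T : nat).
Hypothesis e_gt1 : 1 < e.

Definition bounded (P : nat) (X : nat -> bool) : Prop := forall x, X x -> x < P.

Definition mixed_rows (X : nat -> bool) : {set 'I_T} := [set t : 'I_T | mixed e X t].

Definition left_rows (X : nat -> bool) : {set 'I_T} :=
  [set t : 'I_T | X (t * e) && ~~ X (t * e).+1].

Lemma card_rows (A : {set 'I_T}) : #|A| = \sum_(t < T) (t \in A).
Proof. by rewrite -sum1_card big_mkcond; apply: eq_bigr => t _; case: ifP. Qed.

Lemma left_rows_count (X : nat -> bool) : runner_count e (T * e) 0 X =
  \sum_(t < T) (X (t * e) && X (t * e).+1) + #|left_rows X|.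
Proof.
rewrite runner_countE ?(ltnW e_gt1) // card_rows -big_split /=.
by apply: eq_bigr => t _; rewrite inE addn0; case: (X (t * e)); case: (X _.+1).
Qed.

(** Runner 1 holds a bead in the full rows and in the mixed rows that are not left rows. *)
Lemma right_rows_count (X : nat -> bool) :
  runner_count e (T * e) 1 X + #|left_rows X| =
  \sum_(t < T) (X (t * e) && X (t * e).+1) + #|mixed_rows X|.
Proof.
rewrite runner_countE // !card_rows -!big_split /=.
apply: eq_bigr => t _; rewrite !inE addn1 /mixed.
by case: (X (t * e)); case: (X _.+1).
Qed.

Lemma mixed_rows_frame (X Y : nat -> bool) :
  same_frame e X Y -> mixed_rows X = mixed_rows Y.
Proof. by move=> f; apply/setP => t; rewrite !inE (mixed_frame _ f). Qed.

Lemma full_rows_frame (X Y : nat -> bool) : same_frame e X Y ->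
  \sum_(t < T) (X (t * e) && X (t * e).+1) = \sum_(t < T) (Y (t * e) && Y (t * e).+1).
Proof.
move=> [_ f]; apply: eq_bigr => t _; have := f t.
by case: (X (t * e)); case: (X _.+1); case: (Y (t * e)); case: (Y _.+1).
Qed.

Lemma left_rowsP (X : nat -> bool) (t : 'I_T) :
  t \in mixed_rows X -> (t \in left_rows X) = X (t * e).
Proof. by rewrite !inE /mixed; case: (X (t * e)); case: (X _.+1). Qed.

(** The gap counts are those of [X] whatever [Y] is, so all good configurations of one frame split
    the same set with the same [g]. *)
Lemma good_splits (X Y : nat -> bool) : same_frame e X Y -> good d e Y ->
  splits d (fun t : 'I_T => gaps X (t * e)) (mixed_rows X) (left_rows Y).
Proof.
move=> f gY; rewrite (mixed_rows_frame f); split.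
  by apply/subsetP => t; rewrite !inE /mixed; case: (Y _); case: (Y _).
move=> t u tl uM ul.
have tM : t \in mixed_rows Y by move: tl; rewrite !inE /mixed; case: (Y _); case: (Y _).
move: tl ul; rewrite !left_rowsP // => Yt Yu; rewrite !inE in tM uM.
rewrite /allow !(gaps_frame e_gt1 f) ?modnMl //.
case: ltngtP => [tu|ut|E]; last by rewrite -E Yt in Yu.
  by have [h _] := good_allow e_gt1 gY tM uM tu; apply: h.
by have [_ h] := good_allow e_gt1 gY uM tM ut; apply: h.
Qed.

Lemma good_uniq (X Y : nat -> bool) : 1 < d -> same_frame e X Y ->
  good d e X -> good d e Y -> bounded (T * e) X -> bounded (T * e) Y ->
  runner_count e (T * e) 1 X = runner_count e (T * e) 1 Y -> X =1 Y.
Proof.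
move=> d1 f gX gY bX bY; have := right_rows_count X; have := right_rows_count Y.
rewrite (full_rows_frame f) -(mixed_rows_frame f) => <- E1 E2.
have fX : same_frame e X X by [].
have EL : left_rows X = left_rows Y.
  apply: splits_inj d1 (good_splits fX gX) (good_splits f gY) _.
  by move: E1; rewrite E2 => /addnI.
move=> x; have [f1 f2] := f; have [/f1 //|x1] := ltnP 1 (x %% e).
have [Tx|xT] := leqP (T * e) x.
  have out Z : bounded (T * e) Z -> Z x = false.
    by move=> bZ; apply/negP => /bZ; rewrite ltnNge Tx.
  by rewrite !out.
have tT : x %/ e < T by rewrite ltn_divLR // ltnW.
have := f2 (x %/ e); have : (Ordinal tT \in left_rows X) = (Ordinal tT \in left_rows Y).
  by rewrite EL.
rewrite !inE /=; have := divn_eq x e; move: (x %/ e) (x %% e) x1 => q r r1 ->.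
case: r r1 => [|[|//]] _; rewrite ?addn0 ?addn1;
by case: (X (_ * _)); case: (X _.+1); case: (Y (_ * _)); case: (Y _.+1).
Qed.

(** If the left rows of [Y] are as many as the right rows of [X], then runner 1 of [Y] has as many
    beads as runner 0 of [X], since both runners share the full rows. *)
Lemma good_swap (X : nat -> bool) : bounded (T * e) X -> good d e X ->
  exists Y, [/\ same_frame e X Y, good d e Y, bounded (T * e) Y &
    runner_count e (T * e) 1 Y = runner_count e (T * e) 0 X].
Proof.
move=> bX gX; have fX : same_frame e X X by [].
have [|S' spS' cS'] := splits_compl _ (good_splits fX gX).
  by move=> t u; rewrite inE => tM; apply: gaps_mixed.
have e0 : 0 < e by apply: ltnW.
have mT t : mixed e X t -> t < T.
  rewrite -(ltn_pmul2r e0) /mixed; case Xt: (X (t * e)); first by move=> _; apply: bX.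
  by case Xt': (X _.+1) => // _; apply: ltn_trans (bX _ Xt').
pose inS n := [exists t in S', t == n :> nat].
have inSE (t : 'I_T) : inS t = (t \in S').
  apply/existsP/idP => [[t' /andP[tS /eqP/val_inj <-]] //|tS].
  by exists t; rewrite tS eqxx.
(* On a mixed row this reads [inS] at the left position and its negation at the right one. *)
pose Y x := if (x %% e < 2) && mixed e X (x %/ e)
            then (x %% e == 0) == inS (x %/ e) else X x.
have Y0 t : Y (t * e) = if mixed e X t then inS t else X (t * e).
  by rewrite /Y modnMl mulnK.
have Y1 t : Y (t * e).+1 = if mixed e X t then ~~ inS t else X (t * e).+1.
  by rewrite /Y -[(t * e).+1]addn1 modnMDl divnMDl // modn_small // divn_small // addn0.
have fXY : same_frame e X Y.
  split=> [x x2|t]; first by rewrite /Y ltnNge x2.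
  rewrite Y0 Y1; case: ifP => // Xt; case: (inS t); move: Xt; rewrite /mixed;
  by case: (X (t * e)); case: (X _.+1).
have lY : left_rows Y = S'.
  apply/setP => t; rewrite !inE Y0 Y1.
  have [tM|tM] := boolP (mixed e X t); first by rewrite inSE negbK andbb.
  have -> : (t \in S') = false.
    by apply: contraNF tM => /(subsetP spS'.1); rewrite inE.
  by move: tM; rewrite /mixed; case: (X (t * e)); case: (X _.+1).
exists Y; split=> //.
- apply: (allow_good e_gt1 fXY gX) => t u tM uM tu.
  rewrite /allow_rows !Y0 tM uM -!(gaps_frame e_gt1 fXY) ?modnMl //.
  have [_ hS'] := spS'; split.
    move=> tS uS; have := hS' (Ordinal (mT _ tM)) (Ordinal (mT _ uM)).
    by rewrite -!inSE inE /allow /= tu; apply.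
  move=> uS tS; have := hS' (Ordinal (mT _ uM)) (Ordinal (mT _ tM)).
  by rewrite -!inSE inE /allow /= ltnNge (ltnW tu); apply.
- move=> x; rewrite /Y; case: ifP => [/andP[_ /mT]|_ /bX //].
  by rewrite ltn_divLR.
have := right_rows_count Y; have := left_rows_count X.
rewrite (full_rows_frame fXY) -(mixed_rows_frame fXY) lY cS'.
have : #|left_rows X| <= #|mixed_rows X|.
  by apply: subset_leq_card; case: (good_splits fX gX).
lia.
Qed.
End Rows.

(** * Partitions and their beads *)

Lemma ltn_count_sorted (s : seq nat) (c j : nat) : sorted geq s ->
  (j < count (fun p => c < p) s) = (c < nth 0 s j).
Proof.
elim: s j => [|a s IHs] j /=; first by rewrite nth_nil.
rewrite path_sortedE; last by move=> y x z /= yx zy; apply: leq_trans yx.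
move=> /andP[/allP s_le sorted_s]; have [ca|ac] /= := ltnP c a.
  by case: j => [|j] //=; rewrite add1n ltnS IHs.
have le_c x : x \in s -> (c < x) = false.
  by move=> /s_le /= xa; rewrite ltnNge (leq_trans xa).
rewrite (eq_in_count le_c) count_pred0 addn0 ltn0.
case: j => [|j] /=; first by rewrite ltnNge ac.
by have [/(mem_nth 0)/le_c ->|/(nth_default 0) ->] := ltnP j (size s).
Qed.

Lemma sorted_parts (lam : intpart) : sorted geq lam.
Proof. by case: lam => s /= /andP[]. Qed.

Lemma zero_notin_parts (lam : intpart) : 0 \notin parts lam.
Proof. by case: lam => s /= /andP[]. Qed.

Lemma ltn_conj_part (lam : intpart) (c j : nat) :
  (j < conj_part lam c) = (c < part lam j).
Proof. exact: ltn_count_sorted (sorted_parts lam). Qed.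

Lemma part_gt0_size (lam : intpart) (j : nat) : (0 < part lam j) = (j < size lam).
Proof.
rewrite /part; have [js|sj] := ltnP j (size lam); last by rewrite nth_default.
by rewrite lt0n; apply: contra (zero_notin_parts lam) => /eqP <-; apply: mem_nth.
Qed.

Lemma leq_part (lam : intpart) (i j : nat) : i <= j -> part lam j <= part lam i.
Proof.
move=> ij; rewrite leqNgt -ltn_conj_part; apply/negP => /(leq_ltn_trans ij).
by rewrite ltn_conj_part ltnn.
Qed.

Lemma part_inj (lam mu : intpart) : part lam =1 part mu -> lam = mu.
Proof.
move=> E; apply: val_inj; apply: (@eq_from_nth _ 0) => [|i _]; last exact: E.
have le (a b : intpart) : part a =1 part b -> size a <= size b.
  by move=> ab; rewrite leqNgt -part_gt0_size ab part_gt0_size ltnn.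
by apply/eqP; rewrite eqn_leq !le // => j; rewrite E.
Qed.

Lemma count_mem_conj_part (lam : intpart) (c : nat) :
  count_mem c.+1 (parts lam) + conj_part lam c.+1 = conj_part lam c.
Proof.
rewrite /conj_part; elim: (parts lam) => //= x s <-.
by rewrite addnACA [c < x]leq_eqVlt eq_sym; case: eqP => [<-|]; rewrite ?ltnn.
Qed.

(** At a node of arm 0 the hook length counts the copies of that part from its row downwards, so a
    multiple of [e] means at least [e] copies. *)
Lemma regular_arm (e : nat) (lam : intpart) : 0 < e -> regular e lam <->
  forall r c, node lam r c -> e %| hook lam r c -> 0 < arm lam r c.
Proof.
move=> e0; rewrite /node /hook /arm /leg; split=> [reg r c rc|reg p p_in].
  rewrite -ltn_conj_part in rc; rewrite subn_gt0 => e_hook.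
  have := rc; rewrite ltn_conj_part leq_eqVlt => /orP[/eqP E|//].
  have c_in : c.+1 \in parts lam by rewrite E mem_nth // -part_gt0_size -E.
  have := reg _ c_in; have := count_mem_conj_part lam c.
  have : conj_part lam c.+1 <= r by rewrite leqNgt ltn_conj_part -E ltnn.
  by have := dvdn_leq _ e_hook; rewrite addn1 -E subnn; lia.
rewrite ltnNge; apply/negP => ep.
case: p p_in ep => [p_in|c _ ec]; first by case/negP: (zero_notin_parts lam).
have := count_mem_conj_part lam c; set k := conj_part lam c => Ek.
(* Row [k - e] is the [e]-th from the bottom of column [c]; with at least [e] copies of [c.+1] its
   last node has hook length exactly [e]. *)
have rk : k - e < conj_part lam c by rewrite -/k; lia.
have := rk; rewrite ltn_conj_part => rc; have := reg _ _ rc.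
have rc' : conj_part lam c.+1 <= k - e by lia.
rewrite leqNgt ltn_conj_part -leqNgt in rc'.
have -> : part lam (k - e) - c.+1 = 0 by apply/eqP; rewrite subn_eq0.
have -> : 0 + (conj_part lam c - (k - e).+1) + 1 = e by rewrite -/k; lia.
by move=> /(_ (dvdnn e)).
Qed.

Section Beads.
Variables (N : nat).

(** The [j]-th element of the beta-set shifted by [N]; the subtraction is exact for [j < N]. *)
Definition bead_pos (lam : intpart) (j : nat) : nat := part lam j + (N - j.+1).

Definition bead (lam : intpart) (x : nat) : bool :=
  [exists j : 'I_N, x == bead_pos lam j].

Lemma beadP (lam : intpart) (x : nat) :
  reflect (exists2 j, j < N & x = bead_pos lam j) (bead lam x).
Proof.
apply: (iffP existsP) => [[j /eqP ->]|[j jN ->]]; first by exists j.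
by exists (Ordinal jN).
Qed.

Lemma ltn_bead_pos (lam : intpart) (i j : nat) :
  i < N -> j < N -> (bead_pos lam j < bead_pos lam i) = (i < j).
Proof.
move=> iN jN; rewrite /bead_pos; have [ij|ji] := ltnP i j.
  by have := leq_part lam (ltnW ij); lia.
by have := leq_part lam ji; lia.
Qed.

Definition bead_seq (lam : intpart) : seq nat := [seq bead_pos lam j | j <- iota 0 N].

Lemma mem_bead_seq (lam : intpart) (x : nat) : (x \in bead_seq lam) = bead lam x.
Proof.
apply/mapP/beadP => -[j]; rewrite ?mem_iota => jN ->; exists j => //.
by rewrite mem_iota.
Qed.

Lemma sorted_bead_seq (lam : intpart) : sorted gtn (bead_seq lam).
Proof.
apply: (@homo_sorted_in _ _ (gtn N) _ ltn).
- by move=> i j iN jN ij /=; rewrite ltn_bead_pos.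
- by apply/allP => i; rewrite mem_iota.
exact: iota_ltn_sorted.
Qed.

Lemma gtn_trans : transitive gtn.
Proof. by move=> y x z /= yx zy; apply: ltn_trans yx. Qed.

Lemma uniq_bead_seq (lam : intpart) : uniq (bead_seq lam).
Proof. exact: (sorted_uniq gtn_trans ltnn) (sorted_bead_seq lam). Qed.

Lemma bead_inj (lam mu : intpart) : size lam <= N -> size mu <= N ->
  bead lam =1 bead mu -> lam = mu.
Proof.
move=> lamN muN E; apply: part_inj => j.
have [jN|Nj] := ltnP j N; last first.
  by rewrite /part !nth_default //; [apply: leq_trans muN _ | apply: leq_trans lamN _].
have Es : bead_seq lam = bead_seq mu.
  apply: (irr_sorted_eq gtn_trans ltnn) (sorted_bead_seq _) (sorted_bead_seq _) _.
  by move=> x; rewrite !mem_bead_seq E.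
have := congr1 (nth 0 ^~ j) Es; rewrite !(nth_map 0) ?size_iota // nth_iota //.
by rewrite /bead_pos => /addIn.
Qed.

Lemma sum_beads (lam : intpart) (P : nat) (F : nat -> nat) :
  bounded P (bead lam) ->
  \sum_(x < P) bead lam x * F x = \sum_(j < N) F (bead_pos lam j).
Proof.
move=> bP; rewrite -(big_mkord xpredT (fun x => bead lam x * F x)).
rewrite -(big_mkord xpredT (fun j => F (bead_pos lam j))) /index_iota !subn0.
rewrite -(big_map (bead_pos lam) xpredT F) -/(bead_seq lam).
transitivity (\sum_(x <- [seq x <- iota 0 P | bead lam x]) F x).
  by rewrite big_filter [RHS]big_mkcond; apply: eq_bigr => x _; case: (bead lam x);
     rewrite ?mul1n.
apply: perm_big; apply: uniq_perm; rewrite ?filter_uniq ?iota_uniq ?uniq_bead_seq //.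
move=> x; rewrite mem_filter mem_iota mem_bead_seq /=.
by case E : (bead lam x) => //=; rewrite (bP _ E).
Qed.
End Beads.

Lemma sum_ltn (n k : nat) : \sum_(j < n) (j < k) = minn k n.
Proof.
elim: n => [|n IHn]; first by rewrite big_ord0 minn0.
by rewrite big_ord_recr /= IHn; case: (ltnP n k); lia.
Qed.

Lemma sum_gtn (n k : nat) : \sum_(j < n) (k < j) = n - k.+1.
Proof.
elim: n => [|n IHn]; first by rewrite big_ord0.
by rewrite big_ord_recr /= IHn; case: (ltnP k n); lia.
Qed.

Lemma gapsD (X : nat -> bool) (x : nat) : gaps X x + \sum_(y < x) X y = x.
Proof.
rewrite /gaps -big_split /= -[RHS]card_ord -sum1_card; apply: eq_bigr => y _.
by case: (X y).
Qed.

(** * Hooks as pairs of a bead and an earlier gap *)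

Section Hooks.
Variables (N : nat) (lam : intpart).
Hypothesis lamN : size lam <= N.
Let X := bead N lam.

Lemma bounded_bead : bounded (N + part lam 0) X.
Proof.
move=> x /beadP[j jN ->]; rewrite /bead_pos.
by have := leq_part lam (leq0n j); lia.
Qed.

Lemma sum_beads_below (x : nat) :
  \sum_(y < x) X y = \sum_(j < N) (bead_pos N lam j < x).
Proof.
rewrite -(@sum_beads _ _ (x + (N + part lam 0)) (fun y => y < x)); last first.
  by move=> y /bounded_bead; lia.
rewrite (big_ord_widen (x + (N + part lam 0)) (fun y => nat_of_bool (X y))) ?leq_addr //.
rewrite big_mkcond /=; apply: eq_bigr => y _.
by case: ifP; rewrite ?muln1 ?muln0.
Qed.

(** Of the positions before this bead, exactly [N - r.+1] hold beads, those of the later rows. *)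
Lemma gaps_bead_pos (r : nat) : r < N -> gaps X (bead_pos N lam r) = part lam r.
Proof.
move=> rN; have := gapsD X (bead_pos N lam r); rewrite sum_beads_below.
rewrite (eq_bigr (fun j : 'I_N => nat_of_bool (r < j))); last first.
  by move=> j _; rewrite ltn_bead_pos.
by rewrite sum_gtn {2}/bead_pos => /addIn.
Qed.

(** A row is longer than [gaps X g] exactly when its bead lies beyond [g]; the other rows are the
    beads before [g]. *)
Lemma conj_part_gaps (g : nat) : ~~ X g ->
  conj_part lam (gaps X g) + g = N + gaps X g.
Proof.
move=> Xg; set c := gaps X g.
have <- : \sum_(j < N) (c < part lam j) = conj_part lam c.
  under eq_bigr => j _ do rewrite -ltn_conj_part.
  by rewrite sum_ltn; apply/minn_idPl; apply: leq_trans lamN; apply: count_size.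
have E : \sum_(j < N) (c < part lam j) + \sum_(y < g) X y = N.
  rewrite sum_beads_below -big_split /= -[RHS]card_ord -sum1_card.
  apply: eq_bigr => j _; rewrite -gaps_bead_pos //.
  have Xj : X (bead_pos N lam j) by apply/beadP; exists j.
  case: (ltngtP (bead_pos N lam j) g) => [lt|gt|E]; last by rewrite -E Xj in Xg.
    by rewrite ltnNge leq_gaps // ltnW.
  by rewrite ltn_gaps.
by have := gapsD X g; rewrite -/c; lia.
Qed.

Lemma hook_bead (r g : nat) : r < N -> ~~ X g -> g < bead_pos N lam r ->
  [/\ node lam r (gaps X g), hook lam r (gaps X g) = bead_pos N lam r - g &
      arm lam r (gaps X g) = part lam r - (gaps X g).+1].
Proof.
move=> rN Xg gr; have gap_lt := ltn_gaps Xg gr; rewrite gaps_bead_pos // in gap_lt.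
split=> //; have := conj_part_gaps Xg; have := gap_lt.
rewrite -ltn_conj_part /hook /arm /leg; move: gr; rewrite /bead_pos; lia.
Qed.

(** The gap count rises by one at each gap, so every column below [part lam r] is the count at some
    gap before the bead. *)
Lemma node_gap (r c : nat) : node lam r c ->
  r < N /\ exists g, [/\ ~~ X g, g < bead_pos N lam r & gaps X g = c].
Proof.
rewrite /node => rc.
have rN : r < N.
  by apply: leq_trans _ lamN; rewrite -part_gt0_size; apply: leq_ltn_trans rc.
split=> //; move: rc; rewrite -(gaps_bead_pos rN).
elim: (bead_pos N lam r) => [|x IHx]; first by rewrite /gaps big_ord0.
rewrite gapsS; case Xx: (X x) => /=.
  by rewrite addn0 => /IHx[g [Xg gx <-]]; exists g; split=> //; apply: ltnW.
rewrite addn1 ltnS leq_eqVlt => /orP[/eqP ->|/IHx[g [Xg gx <-]]].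
  by exists x; rewrite Xx.
by exists g; split=> //; apply: ltnW.
Qed.

Lemma good_bead (d e : nat) : 0 < e ->
  good d e X <-> regular e lam /\ balanced d e lam.
Proof.
move=> e0; rewrite (regular_arm lam e0).
have mod_arm (n c : nat) : c < n -> d %| n - c.+1 <-> n = c.+1 %[mod d].
  move=> cn; rewrite -eqn_mod_dvd //; split=> [/eqP|->] //.
have dvd_hook b g : g < b -> e %| b - g <-> g = b %[mod e].
  by move=> gb; rewrite -eqn_mod_dvd ?(ltnW gb) //; split=> [/eqP|->].
split=> [gX|[reg bal] b g /beadP[r rN Eb] Xg gb gbe].
  have P r c : node lam r c -> e %| hook lam r c -> 0 < arm lam r c /\ d %| arm lam r c.
    move=> rc; have [rN [g [Xg gr Ec]]] := node_gap rc.
    rewrite -Ec in rc *; have [_ -> ->] := hook_bead rN Xg gr.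
    move=> /(dvd_hook _ _ gr) E; have Xr : X (bead_pos N lam r) by apply/beadP; exists r.
    have [] := gX _ _ Xr Xg gr E; rewrite gaps_bead_pos // => h1 h2.
    by rewrite subn_gt0; split=> //; apply/mod_arm.
  by split=> r c rc rce; have [] := P r c rc rce.
subst b; have [rc hk ar] := hook_bead rN Xg gb.
have e_hook : e %| hook lam r (gaps X g) by rewrite hk; apply/dvd_hook.
have := reg _ _ rc e_hook; have := bal _ _ rc e_hook.
rewrite ar subn_gt0 /succ_mod gaps_bead_pos // => h1 h2; split=> //.
by apply/mod_arm.
Qed.

Lemma psize_sum : psize lam = \sum_(j < N) part lam j.
Proof.
rewrite /psize sumnE (big_nth 0) big_mkord.
rewrite (@big_ord_widen _ _ _ (size lam) N (part lam)) //.
rewrite [LHS]big_mkcond; apply: eq_bigr => j _; case: ltnP => // /(nth_default 0).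
by rewrite /part.
Qed.

(** The last sum depends on [N] alone, so sizes can be compared through sums of bead positions. *)
Lemma sum_bead (P : nat) : bounded P X ->
  \sum_(x < P) X x * x = psize lam + \sum_(j < N) (N - j.+1).
Proof. by move=> bX; rewrite (sum_beads id bX) psize_sum -big_split. Qed.

Lemma card_bead (P : nat) : bounded P X -> \sum_(x < P) X x = N.
Proof.
move=> bX; under eq_bigr => x _ do rewrite -[nat_of_bool _]muln1.
by rewrite (sum_beads (fun=> 1) bX) sum1_card card_ord.
Qed.
End Hooks.

(** * Recovering a partition from its beads *)

Lemma filter_gt0_sorted (s : seq nat) (j : nat) : sorted geq s ->
  nth 0 [seq x <- s | 0 < x] j = nth 0 s j.
Proof.
elim: s j => [|a s IHs] j //=.
rewrite path_sortedE; last by move=> y x z /= yx zy; apply: leq_trans yx.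
move=> /andP[/allP s_le sorted_s]; case: a s_le => [|a] s_le /=.
  rewrite (_ : [seq x <- s | 0 < x] = [::]).
    case: j => [|j] //=.
    by have [/(mem_nth 0)/s_le|/(nth_default 0)] := ltnP j (size s);
       [rewrite /= leqn0 => /eqP | ] => ->.
  apply/eqP; rewrite -size_eq0 size_filter -leqn0 leqNgt -has_count.
  by apply/hasPn => x /s_le /=; rewrite leqn0 => /eqP ->.
by case: j => //= j; apply: IHs.
Qed.

Lemma intpart_of_seq (s : seq nat) : sorted geq s ->
  exists2 lam : intpart, size lam <= size s & forall j, part lam j = nth 0 s j.
Proof.
move=> sorted_s.
have P : sorted geq [seq x <- s | 0 < x] && (0 \notin [seq x <- s | 0 < x]).
  rewrite mem_filter ltnn andbT; apply: sorted_filter sorted_s.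
  by move=> y x z /= yx zy; apply: leq_trans yx.
exists (Intpart P); first by rewrite size_filter count_size.
by move=> j; rewrite /part /= filter_gt0_sorted.
Qed.

Lemma intpart_of_beads (N P : nat) (X : nat -> bool) :
  bounded P X -> \sum_(x < P) X x = N ->
  exists2 lam : intpart, size lam <= N & bead N lam =1 X.
Proof.
move=> bX cX; pose s := rev [seq x <- iota 0 P | X x].
have size_s : size s = N.
  rewrite size_rev size_filter -cX -(big_mkord xpredT (fun x => nat_of_bool (X x))).
  by rewrite /index_iota subn0 -sum1_count [LHS]big_mkcond.
have sorted_s : sorted gtn s.
  rewrite rev_sorted; apply: sorted_filter (iota_ltn_sorted _ _).
  by move=> y x z /=; apply: ltn_trans.
have s_lt i j : i < j -> j < N -> nth 0 s j < nth 0 s i.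
  move=> ij jN; apply: (sorted_ltn_nth gtn_trans 0 sorted_s) => //;
  by rewrite inE size_s // (ltn_trans ij).
(* Entry [j] is followed by [N - j.+1] strictly smaller naturals; hence the subtraction defining the
   parts is exact. *)
have s_ge j : j < N -> N - j.+1 <= nth 0 s j.
  move Ek : (N - j.+1) => k; elim: k j Ek => // k IHk j Ek jN.
  have j1N : j.+1 < N by lia.
  by apply: leq_ltn_trans (s_lt j j.+1 _ _) => //; apply: IHk => //; lia.
have [|lam size_lam Elam] := @intpart_of_seq (mkseq (fun j => nth 0 s j - (N - j.+1)) N).
  apply/(sortedP 0) => i; rewrite size_mkseq => iN.
  rewrite !nth_mkseq //=; last exact: ltnW.
  by have := s_lt _ _ (ltnSn i) iN; have := s_ge _ iN; lia.
rewrite size_mkseq in size_lam; exists lam => // x.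
have posE j : j < N -> bead_pos N lam j = nth 0 s j.
  by move=> jN; rewrite /bead_pos Elam nth_mkseq // subnK // s_ge.
have -> : X x = (x \in s).
  rewrite mem_rev mem_filter mem_iota /= add0n; case Xx: (X x) => //=.
  by rewrite bX.
apply/beadP/idP => [[j jN ->]|xs]; first by rewrite posE // mem_nth // size_s.
have js : index x s < N by rewrite -size_s index_mem.
by exists (index x s); rewrite // posE // nth_index.
Qed.

(** * Cores *)

(* Position x of X stands for the integer x - N; all integers below -N are
   occupied. *)
Definition charted (N : nat) (B : set int) (X : nat -> bool) : Prop :=
  (forall x : nat, B (x%:Z - N%:Z)%R <-> X x) /\
  (forall z : int, (z < - N%:Z)%R -> B z).

Lemma charted_beta_set (N : nat) (lam : intpart) :
  size lam <= N -> charted N (beta_set lam) (bead N lam).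
Proof.
move=> lamN; have part0 j : N <= j -> part lam j = 0.
  by move=> Nj; rewrite /part nth_default // (leq_trans lamN).
split=> [x|z zN].
  split=> [[j _ E]|/beadP[j jN ->]]; last by exists j => //; rewrite /bead_pos; lia.
  have [jN|Nj] := ltnP j N; last by have := part0 _ Nj; lia.
  by apply/beadP; exists j => //; rewrite /bead_pos; lia.
exists (absz z).-1 => //; have := part0 (absz z).-1; lia.
Qed.

Lemma charted_eq (N : nat) (B : set int) (X Y : nat -> bool) :
  charted N B X -> charted N B Y -> X =1 Y.
Proof. by move=> [hX _] [hY _] x; apply/idP/idP => [/hX/hY|/hY/hX]. Qed.

Lemma charted_inj (N : nat) (B C : set int) (X Y : nat -> bool) :
  charted N B X -> charted N C Y -> X =1 Y -> B = C.
Proof.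
move=> [hX lX] [hY lY] E; apply/funext => z; apply/propext.
have [zN|Nz] := boolP (z < - N%:Z)%R; first by split=> _; [apply: lY | apply: lX].
have -> : z = ((absz (z + N%:Z)%R)%:Z - N%:Z)%R by lia.
by split=> [/hX|/hY]; [rewrite E => /hY | rewrite -E => /hX].
Qed.

Definition shift_bead (e x : nat) (X : nat -> bool) (y : nat) : bool :=
  (y == x) || (y != x + e) && X y.

Lemma bounded_shift_bead (P e x : nat) (X : nat -> bool) : X (x + e) ->
  bounded P X -> bounded P (shift_bead e x X).
Proof.
move=> Xxe bX y /orP[/eqP ->|/andP[_ /bX //]].
by have := bX _ Xxe; lia.
Qed.

(** Used with [F] the identity, to see the sum of positions decrease, and with [F] the indicator of
    a runner, to see its count preserved. *)
Lemma sum_shift_bead (P e x : nat) (X : nat -> bool) (F : nat -> nat) :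
  0 < e -> X (x + e) -> ~~ X x -> bounded P X ->
  \sum_(y < P) shift_bead e x X y * F y + F (x + e) =
  \sum_(y < P) X y * F y + F x.
Proof.
move=> e0 Xxe Xx bX; have xeP := bX _ Xxe; have xP : x < P by lia.
have sum1 (z : nat) : z < P -> \sum_(y < P) (y == z :> nat) * F y = F z.
  move=> zP; rewrite (bigD1 (Ordinal zP)) //= eqxx mul1n big1 ?addn0 // => y.
  by rewrite -val_eqE /= => /negPf ->.
rewrite -(sum1 _ xeP) -(sum1 _ xP) -!big_split; apply: eq_bigr => y _ /=.
rewrite -!mulnDl /shift_bead; congr (_ * _).
case: (eqVneq (y : nat) x) => [->|_] /=.
  by rewrite (negPf Xx) -{1}[x]addn0 eqn_add2l eq_sym gtn_eqF.
by case: eqVneq => [->|_]; rewrite ?Xxe ?addn0.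
Qed.

Lemma charted_move (N e : nat) (B B' : set int) (X : nat -> bool) : 0 < e ->
  charted N B X -> bead_move e B B' ->
  exists x, [/\ X (x + e), ~~ X x & charted N B' (shift_bead e x X)].
Proof.
move=> e0 [hX lX] [b [Bb Bbe ->]].
(* All integers below [-N] are occupied, so a move cannot leave the chart. *)
have Nb : (- N%:Z <= b - e%:Z)%R 
  by apply/negPn/negP => h; apply: Bbe; apply: lX; lia.
pose x := absz (b - e%:Z + N%:Z)%R.
have Ex : (b - e%:Z = x%:Z - N%:Z)%R by rewrite /x; lia.
have Exe : (b = (x + e)%:Z - N%:Z)%R by lia.
exists x; split; first by apply/hX; rewrite -Exe.
  by apply/negP => /hX; rewrite -Ex.
split=> [y|z zN]; last by left; split; [apply: lX | move=> /= E; lia].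
rewrite /shift_bead; split.
  case=> [[/hX Xy] /= yb|/= yb].
    by rewrite Xy andbT orbC; case: eqVneq => // E; case: yb; lia.
  by rewrite (_ : y = x) ?eqxx //; lia.
case/orP => [/eqP ->|/andP[/eqP yxe /hX By]]; first by right => /=; lia.
by left; split=> //= E; apply: yxe; lia.
Qed.

Lemma move_charted (N e : nat) (B : set int) (X : nat -> bool) (x : nat) : 0 < e ->
  charted N B X -> X (x + e) -> ~~ X x ->
  exists2 B', bead_move e B B' & charted N B' (shift_bead e x X).
Proof.
move=> e0 [hX lX] Xxe Xx; set b := ((x + e)%:Z - N%:Z)%R.
have Ebe : (b - e%:Z = x%:Z - N%:Z)%R by rewrite /b; lia.
exists ((B `\ b) `|` [set (b - e%:Z)%R])%classic.
  exists b; split=> //; first by apply/hX.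
  by rewrite Ebe => /hX; apply/negP.
split=> [y|z zN]; last by left; split; [apply: lX | move=> /= E; lia].
rewrite /shift_bead; split.
  case=> [[/hX Xy] /= yb|/= yb].
    by rewrite Xy andbT orbC; case: eqVneq => // E; case: yb; rewrite E.
  by rewrite (_ : y = x) ?eqxx //; lia.
case/orP => [/eqP ->|/andP[/eqP yxe /hX By]]; first by right => /=; lia.
by left; split=> //= E; apply: yxe; lia.
Qed.

Definition down_closed (e : nat) (X : nat -> bool) : Prop :=
  forall x, X (x + e) -> X x.

Lemma down_closed_charted (N e : nat) (B : set int) (X : nat -> bool) : 0 < e ->
  charted N B X -> down_closed e X <-> ~ (exists B', bead_move e B B').
Proof.
move=> e0 BX; split=> [dX [B' /(charted_move e0 BX)[x [/dX -> //]]]|noB x Xxe].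
apply/negPn/negP => Xx; apply: noB.
by have [B' BB' _] := move_charted e0 BX Xxe Xx; exists B'.
Qed.

Lemma down_closedM (e x k : nat) (X : nat -> bool) :
  down_closed e X -> X (x + k * e) -> X x.
Proof.
move=> dX; elim: k => [|k IHk]; first by rewrite addn0.
by rewrite mulSn addnCA addnC => /dX.
Qed.

(** If [x] is a bead of [U] but not of [V], every bead of [V] on its runner lies below [x] and is
    therefore a bead of [U]; so [U] has more beads there. *)
Lemma down_closed_uniq (e P : nat) (X Y : nat -> bool) : 0 < e ->
  down_closed e X -> down_closed e Y -> bounded P X -> bounded P Y ->
  (forall r, r < e -> runner_count e P r X = runner_count e P r Y) -> X =1 Y.
Proof.
move=> e0; have main (U V : nat -> bool) x : down_closed e U -> down_closed e V ->
    bounded P U -> (forall r, r < e -> runner_count e P r U = runner_count e P r V) ->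
    U x -> V x.
  move=> dU dV bU cUV Ux; apply/negPn/negP => Vx.
  have := cUV (x %% e); rewrite ltn_mod e0 => /(_ isT); apply/eqP.
  rewrite eqn_leq negb_and -!ltnNge; apply/orP; left.
  rewrite /runner_count [X in _ < X](bigD1 (Ordinal (bU _ Ux))) //=.
  rewrite [X in X < _](bigD1 (Ordinal (bU _ Ux))) //= (negPf Vx) Ux eqxx /=.
  rewrite mul0n add0n muln1 add1n ltnS; apply: leq_sum => y _.
  case: eqP => [E|_]; last by rewrite !muln0.
  rewrite !muln1; case Vy: (V y) => //; case Uy: (U y) => //.
  have [yx|xy] := leqP y x.
    have Ex : x = y + (x %/ e - y %/ e) * e.
      rewrite {1}(divn_eq x e) -{1}E {2}(divn_eq y e) mulnBl.
      by have := leq_mul (leq_div2r e yx) (leqnn e); lia.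
    by move: Ux; rewrite Ex => /(down_closedM dU); rewrite Uy.
  have Ey : (y : nat) = x + (y %/ e - x %/ e) * e.
    rewrite {1}(divn_eq y e) E {2}(divn_eq x e) mulnBl.
    by have := leq_mul (leq_div2r e (ltnW xy)) (leqnn e); lia.
  by move: Vy; rewrite Ey => /(down_closedM dV); rewrite (negPf Vx).
move=> dX dY bX bY cXY x; apply/idP/idP; first exact: main.
by apply: main => // r /cXY.
Qed.

Lemma runner_count_shift (P e x r : nat) (X : nat -> bool) :
  0 < e -> X (x + e) -> ~~ X x -> bounded P X ->
  runner_count e P r (shift_bead e x X) = runner_count e P r X.
Proof.
move=> e0 Xxe Xx bX; have := sum_shift_bead (fun y => y %% e == r) e0 Xxe Xx bX.
by rewrite modnDr => /addIn.
Qed.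

Lemma charted_chain (N e P : nat) (B B' : set int) (X : nat -> bool) : 0 < e ->
  charted N B X -> bounded P X -> clos_refl_trans _ (bead_move e) B B' ->
  exists Y, [/\ charted N B' Y, bounded P Y &
    forall r, runner_count e P r Y = runner_count e P r X].
Proof.
move=> e0 BX bX BB'; elim: BB' X BX bX => {B B'} [B B' BB'|B|B C D _ IH1 _ IH2] X BX bX.
- have [x [Xxe Xx B'X]] := charted_move e0 BX BB'.
  exists (shift_bead e x X); split=> //; first exact: bounded_shift_bead.
  by move=> r; apply: runner_count_shift.
- by exists X.
have [Y [CY bY cY]] := IH1 _ BX bX; have [Z [DZ bZ cZ]] := IH2 _ CY bY.
by exists Z; split=> // r; rewrite cZ.
Qed.

(** Every move lowers the sum of the bead positions, so moving stops. *)
Lemma chain_to_core (N e P : nat) (B : set int) (X : nat -> bool) : 0 < e ->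
  charted N B X -> bounded P X ->
  exists B' Y, [/\ clos_refl_trans _ (bead_move e) B B', charted N B' Y,
    bounded P Y, down_closed e Y &
    forall r, runner_count e P r Y = runner_count e P r X].
Proof.
move=> e0; have [m] := ubnP (\sum_(x < P) X x * x).
elim: m B X => // m IHm B X Xm BX bX.
have [dX|ndX] := pselect (down_closed e X).
  by exists B, X; split=> //; apply: rt_refl.
have [x Xxe Xx] : exists2 x, X (x + e) & ~~ X x.
  by apply: contra_notP ndX => noX x Xxe; apply/negPn/negP => Xx; apply: noX; exists x.
have [C BC CX] := move_charted e0 BX Xxe Xx.
have [||B' [Y [CB' B'Y bY dY cY]]] := IHm C (shift_bead e x X) _ CX.
- by have := sum_shift_bead id e0 Xxe Xx bX; lia.
- exact: bounded_shift_bead.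
exists B', Y; split=> //; first exact: rt_trans (rt_step _ _ _ _ BC) CB'.
by move=> r; rewrite cY runner_count_shift.
Qed.

(** Moves preserve the runner counts, and these determine a configuration without further moves. *)
Lemma is_core_ofP (N e P : nat) (gam lam : intpart) : 0 < e ->
  size gam <= N -> size lam <= N ->
  bounded P (bead N gam) -> bounded P (bead N lam) ->
  is_core_of e gam lam <-> down_closed e (bead N gam) /\
    forall r, r < e ->
      runner_count e P r (bead N lam) = runner_count e P r (bead N gam).
Proof.
move=> e0 gN lN bg bl; have Cg := charted_beta_set gN; have Cl := charted_beta_set lN.
rewrite /is_core_of -(down_closed_charted e0 Cg).
split=> [[chain dg]|[dg cgl]]; split=> //.
  have [Y [CY bY cY]] := charted_chain e0 Cl bl chain.
  by move=> r _; rewrite -cY /runner_count; apply: eq_bigr => y _;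
     rewrite (charted_eq CY Cg).
have [B' [Y [chain CY bY dY cY]]] := chain_to_core e0 Cl bl.
suff <- : B' = beta_set gam by [].
apply: charted_inj CY Cg _; apply: (down_closed_uniq e0 dY dg bY bg) => r re.
by rewrite cY cgl.
Qed.

(** * Exchanging two runners *)

Section RunnerCounts.
Variables (e T : nat).
Hypothesis e_gt1 : 1 < e.

Lemma runner_count_frame (X Y : nat -> bool) (r : nat) : same_frame e X Y ->
  1 < r -> r < e -> runner_count e (T * e) r X = runner_count e (T * e) r Y.
Proof.
move=> [f _] r1 re; rewrite !runner_countE //; apply: eq_bigr => t _.
by rewrite f // modnMDl modn_small.
Qed.

Lemma runner_count01_frame (X Y : nat -> bool) : same_frame e X Y ->
  runner_count e (T * e) 0 X + runner_count e (T * e) 1 X =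
  runner_count e (T * e) 0 Y + runner_count e (T * e) 1 Y.
Proof.
move=> [_ f]; rewrite !runner_countE ?(ltnW e_gt1) // -!big_split.
by apply: eq_bigr => t _ /=; rewrite !addn0 !addn1 f.
Qed.

(** Moving a bead of a row from runner 0 to runner 1 adds one to both the sum of positions and the
    count of runner 1. *)
Lemma sum_frame (X Y : nat -> bool) : same_frame e X Y ->
  \sum_(x < T * e) X x * x + runner_count e (T * e) 1 Y =
  \sum_(x < T * e) Y x * x + runner_count e (T * e) 1 X.
Proof.
move=> [f1 f2]; rewrite !runner_countE //.
rewrite (sum_runners T e (fun x => X x * x)) (sum_runners T e (fun x => Y x * x)).
rewrite -!big_split; apply: eq_bigr => t _ /=.
case: e e_gt1 f1 f2 => [|[|e']] // _ f1 f2; rewrite !big_ord_recl /= !addnA.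
rewrite (eq_bigr (fun s : 'I_e' => Y (t * e'.+2 + bump 0 (bump 0 s)) *
                                   (t * e'.+2 + bump 0 (bump 0 s)))); last first.
  by move=> s _; rewrite f1 // modnMDl modn_small // /bump /= !ltnS.
have := f2 t; rewrite /bump /= !addn0 !addn1.
case: (X (t * _)); case: (X _.+1); case: (Y (t * _)); case: (Y _.+1) => //= _;
lia.
Qed.
End RunnerCounts.

Section Link.
Variables (d e N T : nat).
Hypothesis e_gt1 : 1 < e.
Let e_gt0 : 0 < e := ltnW e_gt1.
Let P := T * e.

Definition fits (lam : intpart) : Prop := size lam <= N /\ bounded P (bead N lam).

(** The graph of the bijection between blocks. By [runner_count01_frame], prescribing the count of
    runner 1 makes the two counts trade places. *)
Definition linked (lam mu : intpart) : Prop :=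
  same_frame e (bead N lam) (bead N mu) /\
  runner_count e P 1 (bead N mu) = runner_count e P 0 (bead N lam).

Lemma linked_sym (lam mu : intpart) : linked lam mu -> linked mu lam.
Proof.
move=> [f c]; split; first exact: same_frame_sym.
by have := runner_count01_frame T e_gt1 f; rewrite -/P; lia.
Qed.

Lemma linked_psize (lam mu : intpart) : fits lam -> fits mu -> linked lam mu ->
  psize lam + runner_count e P 0 (bead N lam) =
  psize mu + runner_count e P 1 (bead N lam).
Proof.
move=> [lN bl] [mN bm] [f c]; have := sum_frame T e_gt1 f; rewrite -/P c.
by rewrite (sum_bead lN bl) (sum_bead mN bm); lia.
Qed.

(** Since [lam] and [gam] have the same runner counts, and both links exchange the first two and
    keep the others, [mu] and [gam'] agree too; both sizes change by the same amount. *)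
Lemma linked_block (w : nat) (gam gam' lam mu : intpart) :
  fits gam -> fits gam' -> fits lam -> fits mu ->
  linked gam gam' -> linked lam mu -> is_core e gam' ->
  block e gam w lam -> block e gam' w mu.
Proof.
move=> Fg Fg' Fl Fm Lg Ll core_g' [core_gl size_l].
have [gN bg] := Fg; have [gN' bg'] := Fg'; have [lN bl] := Fl; have [mN bm] := Fm.
have [dg' _] := proj1 (is_core_ofP e_gt0 gN' gN' bg' bg') core_g'.
have [_ c] := proj1 (is_core_ofP e_gt0 gN lN bg bl) core_gl.
have c0 := c 0 e_gt0; have c1 := c 1 e_gt1; split; last first.
  by have := linked_psize Fg Fg' Lg; have := linked_psize Fl Fm Ll; lia.
apply/(is_core_ofP e_gt0 gN' mN bg' bm); split=> // r re.
have [f1 h1] := Lg; have [f2 h2] := Ll.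
case: r re => [_|[_|r re]]; last 1 first.
- by rewrite -(runner_count_frame T f1) // -(runner_count_frame T f2) // c.
- have [_ <-] := linked_sym Ll; have [_ <-] := linked_sym Lg; exact: c1.
by rewrite h1 h2.
Qed.

Lemma linked_exists (lam : intpart) : fits lam -> regular e lam -> balanced d e lam ->
  exists mu, [/\ fits mu, linked lam mu, regular e mu & balanced d e mu].
Proof.
move=> [lN bl] rl ball; have gl : good d e (bead N lam) by apply/good_bead.
have [Y [f gY bY cY]] := good_swap e_gt1 bl gl.
(* [P] is the start of a row, so both configurations have equally many gaps, hence beads, before
   it. *)
have sumY : \sum_(x < P) Y x = N.
  have := gapsD (bead N lam) P; rewrite -[RHS](gapsD Y) card_bead //.
  by rewrite (gaps_frame e_gt1 f) ?modnMl // => /addnI.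
have [mu mN Emu] := intpart_of_beads bY sumY.
have Eb : bead N mu = Y by apply/funext.
have [] : regular e mu /\ balanced d e mu by apply/(good_bead mN) => //; rewrite Eb.
by exists mu; rewrite /fits /linked Eb.
Qed.

Lemma linked_uniq (lam mu mu' : intpart) : 1 < d -> fits mu -> fits mu' ->
  linked lam mu -> linked lam mu' ->
  regular e mu -> balanced d e mu -> regular e mu' -> balanced d e mu' -> mu = mu'.
Proof.
move=> d1 [mN bm] [mN' bm'] [f c] [f' c'] rm blm rm' blm'.
apply: (bead_inj mN mN').
apply: (good_uniq e_gt1 d1 _ _ _ bm bm'); last by rewrite c c'.
- exact: same_frame_trans (same_frame_sym f) f'.
- exact/good_bead.
exact/good_bead.
Qed.
End Link.

(** * Equinumerous sets, size bounds and finiteness *)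

Lemma card_eq_rel (T U : Type) (A : set T) (B : set U) (R : T -> U -> Prop) :
  (forall a, A a -> exists2 b, B b & R a b) ->
  (forall b, B b -> exists2 a, A a & R a b) ->
  (forall a b b', B b -> B b' -> R a b -> R a b' -> b = b') ->
  (forall a a' b, A a -> A a' -> R a b -> R a' b -> a = a') ->
  (A #= B)%card.
Proof.
move=> AB BA Ru Rl; apply/card_bijP.
have [|f Rf] := @choice A B (fun a b => R (val a) (val b)).
  move=> [a aA]; have [b bB Rab] := AB a (set_mem aA).
  by exists (SigSub (mem_set bB)).
have [|g Rg] := @choice B A (fun b a => R (val a) (val b)).
  move=> [b bB]; have [a aA Rab] := BA b (set_mem bB).
  by exists (SigSub (mem_set aA)).
exists f; exists g => x; apply: val_inj.
  exact: Rl (set_valP _) (set_valP _) (Rg _) (Rf _).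
exact: Ru (set_valP _) (set_valP _) (Rf _) (Rg _).
Qed.

Lemma leq_size_psize (lam : intpart) : size lam <= psize lam.
Proof.
rewrite (psize_sum (leqnn _)) -{1}[size lam]card_ord -sum1_card.
by apply: leq_sum => j _; rewrite part_gt0_size.
Qed.

Lemma leq_part_psize (lam : intpart) : part lam 0 <= psize lam.
Proof. by rewrite (psize_sum (leqnSn _)) big_ord_recl leq_addr. Qed.

Lemma psize_eq0 (lam : intpart) : psize lam = 0 -> parts lam = [::].
Proof. by move=> E; apply/size0nil/eqP; rewrite -leqn0 -E leq_size_psize. Qed.

Lemma fits_psize (e N T n : nat) (lam : intpart) :
  psize lam <= n -> n <= N -> N + n <= T * e -> fits e N T lam.
Proof.
move=> ln nN NT; have lN : size lam <= N.
  by apply: leq_trans nN; apply: leq_trans ln; apply: leq_size_psize.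
split=> // x /(bounded_bead lN); have := leq_part_psize lam; lia.
Qed.

Lemma finite_psize (n : nat) : finite_set [set lam : intpart | psize lam = n]%classic.
Proof.
have P0 : sorted geq [::] && (0 \notin [::]) by [].
(* Length and parts are at most [n]; sequences that are not partitions go to the default, the empty
   partition. *)
pose f (s : {bseq n of 'I_n.+1}) : intpart := insubd (Intpart P0) (map val s).
apply: (@sub_finite_set _ _ (f @` classical_sets.setT)%classic);
  last exact/finite_image/finite_finset.
move=> lam /= lam_n.
have size_l : size (map (@inord n) lam) <= n by rewrite size_map -lam_n leq_size_psize.
exists (Bseq size_l) => //; apply: val_inj.
have E : map val (map (@inord n) lam) = parts lam.
  rewrite -map_comp -[RHS]map_id; apply/eq_in_map => x /(nthP 0)[j _ <-] /=.
  rewrite inordK // ltnS -lam_n; apply: leq_trans (leq_part_psize lam).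
  exact: (leq_part lam (leq0n j)).
rewrite /f /= E val_insubd; case: ifP => //.
by rewrite sorted_parts zero_notin_parts.
Qed.

(** * Exchanging two whole runners of a core *)

Definition swap_runners (e : nat) (X : nat -> bool) (x : nat) : bool :=
  if x %% e == 0 then X x.+1 else if x %% e == 1 then X x.-1 else X x.

Section SwapRunners.
Variables (e T : nat) (X : nat -> bool).
Hypothesis e_gt1 : 1 < e.
Hypothesis bX : bounded (T * e) X.
Let Y := swap_runners e X.

Lemma swap_runners0 (t : nat) : Y (t * e) = X (t * e).+1.
Proof. by rewrite /Y /swap_runners modnMl. Qed.

Lemma swap_runners1 (t : nat) : Y (t * e).+1 = X (t * e).
Proof. by rewrite /Y /swap_runners -[(t * e).+1]addn1 modnMDl modn_small // addn1. Qed.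

Lemma swap_runners_frame : same_frame e X Y.
Proof.
split=> [x x2|t]; last by rewrite swap_runners0 swap_runners1 addnC.
by rewrite /Y /swap_runners; case: (x %% e) x2 => [|[|]].
Qed.

Lemma bounded_swap_runners : bounded (T * e) Y.
Proof.
move=> x; rewrite /Y /swap_runners; have Ex := divn_eq x e.
case x_mod : (x %% e) Ex => [|[|r]] /= Ex => [/bX|/bX|/bX //]; first exact: ltnW.
move: Ex; rewrite addn1 => Ex; rewrite Ex /= ltn_mul2r => /andP[_ tT].
by have := leq_mul tT (leqnn e); rewrite mulSn; lia.
Qed.

Lemma runner_count_swap :
  runner_count e (T * e) 1 Y = runner_count e (T * e) 0 X.
Proof.
rewrite !runner_countE ?(ltnW e_gt1) //; apply: eq_bigr => t _.
by rewrite addn1 addn0 swap_runners1.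
Qed.

Lemma down_closed_swap_runners : down_closed e X -> down_closed e Y.
Proof.
move=> dX x; rewrite /Y /swap_runners modnDr; case: ifP => [_|x0].
  by rewrite -addSn; apply: dX.
case: ifP => _; last exact: dX.
by case: x x0 => [|x _]; [rewrite mod0n | rewrite addSn; apply: dX].
Qed.

(** Left beads occur only in rows before [t], and those rows also have right beads; row [t] makes
    the inequality strict. *)
Lemma runner_count_lt (t : nat) : down_closed e X -> ~~ X (t * e) -> X (t * e).+1 ->
  runner_count e (T * e) 0 X < runner_count e (T * e) 1 X.
Proof.
move=> dX X0 X1; rewrite !runner_countE ?(ltnW e_gt1) //.
have tT : t < T by rewrite -(ltn_pmul2r (ltnW e_gt1)); have := bX X1; lia.
rewrite [X in X < _](bigD1 (Ordinal tT)) // [X in _ < X](bigD1 (Ordinal tT)) //=.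
rewrite addn0 addn1 (negPf X0) X1 ltnS.
apply: leq_sum => u _; rewrite addn0 addn1; case Xu : (X (u * e)) => //.
have ut : u < t.
  rewrite ltnNge; apply: contra X0 => tu; apply: (down_closedM (k := u - t) dX).
  by rewrite -mulnDl subnKC // Xu.
have := @down_closedM e (u * e).+1 (t - u) X dX.
by rewrite addSn -mulnDl subnKC ?(ltnW ut) // X1 => ->.
Qed.
End SwapRunners.

(** The last part has a removable node: the beads after it belong to zero parts and lie below
    [N - j.+1]. *)
Lemma bead_moves_down (N : nat) (lam : intpart) (j : nat) :
  j.+1 < N -> size lam = j.+1 -> ~~ bead N lam (bead_pos N lam j).-1.
Proof.
move=> jN size_l; have pj : 0 < part lam j by rewrite part_gt0_size size_l.
apply/negP => /beadP[i iN]; have [ij|ji] := leqP i j.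
  by have := leq_part lam ij; rewrite /bead_pos; lia.
have -> : bead_pos N lam i = N - i.+1.
  by rewrite /bead_pos /part nth_default // size_l.
by rewrite /bead_pos; lia.
Qed.

(** * Comparing blocks and descending to the empty core *)

Definition good_block (d e w : nat) (gam : intpart) : set intpart :=
  [set lam | [/\ block e gam w lam, regular e lam & balanced d e lam]]%classic.

(** The number [n] bounds the sizes of all partitions in both blocks, so one abacus serves them
    all. *)
Lemma linked_good_block (d e w N T n : nat) (gam gam' : intpart) :
  1 < d -> 1 < e -> n <= N -> N + n <= T * e ->
  psize gam + e * w <= n -> psize gam' + e * w <= n ->
  is_core e gam -> is_core e gam' -> linked e N T gam gam' ->
  (good_block d e w gam #= good_block d e w gam')%card.
Proof.
move=> d1 e1 nN NT gn gn' cg cg' Lg.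
have fitsW lam : psize lam <= n -> fits e N T lam by move=> ?; apply: fits_psize NT.
have Fg : fits e N T gam by apply: fitsW; lia.
have Fg' : fits e N T gam' by apply: fitsW; lia.
have Fb lam : good_block d e w gam lam -> fits e N T lam.
  by case=> -[_ E] _ _; apply: fitsW; lia.
have Fb' lam : good_block d e w gam' lam -> fits e N T lam.
  by case=> -[_ E] _ _; apply: fitsW; lia.
apply: (@card_eq_rel _ _ _ _ (linked e N T)).
- move=> lam blam; have Fl := Fb _ blam; case: blam => bl rl ball.
  have [mu [Fm Ll rm balm]] := linked_exists e1 Fl rl ball.
  by exists mu => //; split=> //; apply: (linked_block e1 Fg Fg' Fl Fm Lg Ll).
- move=> mu bmu; have Fm := Fb' _ bmu; case: bmu => bm rm balm.
  have [lam [Fl Lm rl ball]] := linked_exists e1 Fm rm balm.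
  exists lam; last exact: linked_sym.
  by split=> //; apply: (linked_block e1 Fg' Fg Fm Fl (linked_sym e1 Lg) Lm).
- move=> lam mu mu' bm bm' Lm Lm'.
  have Fm := Fb' _ bm; have Fm' := Fb' _ bm'; case: bm bm' => _ rm blm [_ rm' blm'].
  exact: linked_uniq Lm Lm' rm blm rm' blm'.
move=> lam lam' mu bl bl' /(linked_sym e1) Ll /(linked_sym e1) Ll'.
have Fl := Fb _ bl; have Fl' := Fb _ bl'; case: bl bl' => _ rl bll [_ rl' bll'].
exact: linked_uniq Ll Ll' rl bll rl' bll'.
Qed.

Lemma good_block_smaller_core (d e w : nat) (gam : intpart) :
  1 < d -> 1 < e -> is_core e gam -> 0 < psize gam ->
  exists gam', [/\ is_core e gam', psize gam' < psize gam &
    (good_block d e w gam #= good_block d e w gam')%card].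
Proof.
move=> d1 e1 cg g0; have e0 := ltnW e1.
set n := psize gam + e * w.
have [j Ej] : exists j, size gam = j.+1.
  by case E: (size gam) => [|j]; [move: g0; rewrite /psize (size0nil E) | exists j].
pose p := part gam j; have p_gt0 : 0 < p by rewrite /p part_gt0_size Ej.
(* This [N] puts the bead of the last part, at [p + (N - j.+1)], on position [(t * e).+1] of runner
   1; [t] and [T] are large enough for [n <= N] and [N + n <= T * e]. *)
pose t := p + n; pose N := t * e + j.+2 - p; pose T := N + n.
have pt : p + n <= t * e by rewrite -{1}[p + n]muln1 leq_mul.
have nN : n <= N by rewrite /N; lia.
have NT : N + n <= T * e by rewrite -{1}[N + n]muln1 leq_mul.
have Fg : fits e N T gam by apply: fits_psize NT => //; apply: leq_addr.
have [gN bg] := Fg; pose X := bead N gam.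
have jN : j.+1 < N by rewrite /N; lia.
have posj : bead_pos N gam j = (t * e).+1 by rewrite /bead_pos -/p /N; lia.
have X1 : X (t * e).+1 by apply/beadP; exists j; rewrite ?posj // ltnW.
have X0 : ~~ X (t * e) by have := bead_moves_down jN Ej; rewrite posj.
have [dX _] := proj1 (is_core_ofP e0 gN gN bg bg) cg.
pose Y := swap_runners e X; have fXY : same_frame e X Y by apply: swap_runners_frame.
have bY : bounded (T * e) Y by apply: bounded_swap_runners.
have sumY : \sum_(x < T * e) Y x = N.
  have := gapsD X (T * e); rewrite -[RHS](gapsD Y) card_bead //.
  by rewrite (gaps_frame e1 fXY) ?modnMl // => /addnI.
have [gam' gN' Eg'] := intpart_of_beads bY sumY.
have EY : bead N gam' = Y by apply/funext.
have bg' : bounded (T * e) (bead N gam') by rewrite EY.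
have Lg : linked e N T gam gam' by split; rewrite EY //; apply: runner_count_swap.
have cg' : is_core e gam'.
  apply/(is_core_ofP e0 gN' gN' bg' bg'); split=> //; rewrite EY.
  exact: down_closed_swap_runners.
(* The size drops by the excess of runner 1 over runner 0, which is positive by the choice of
   [N]. *)
have lt_psize : psize gam' < psize gam.
  have := linked_psize e1 Fg (conj gN' bg') Lg.
  by have := runner_count_lt e1 bg dX X0 X1; lia.
exists gam'; split=> //; apply: (linked_good_block d1 e1 nN NT) => //.
by rewrite leq_add2r ltnW.
Qed.

Lemma finite_good_block (d e w : nat) (gam : intpart) :
  finite_set (good_block d e w gam).
Proof.
apply: (sub_finite_set _ (finite_psize (psize gam + e * w))).
by move=> lam [[_ E] _ _].
Qed.

Local Open Scope classical_set_scope.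
Local Open Scope card_scope.

Theorem corollary4p5 (d e w : nat) (hd : 1 < d) (he : 1 < e) :
  exists N : nat, forall gam : intpart, is_core e gam ->
    [set lam | [/\ block e gam w lam, regular e lam & balanced d e lam]] #= `I_N.
Proof.
have P0 : sorted geq [::] && (0 \notin [::]) by [].
(* The common number is that of the block of the empty core; the others reach it by induction on the
   size of the core. *)
have /finite_setP[N EN] := finite_good_block d e w (Intpart P0).
exists N => gam; rewrite -/(good_block d e w gam).
have [m] := ubnP (psize gam); elim: m gam => // m IHm gam gam_m cg.
have [/psize_eq0 gam0|gam_gt0] := posnP (psize gam).
  by rewrite (_ : gam = Intpart P0) //; apply: val_inj.
have [gam' [cg' lt_g E]] := good_block_smaller_core w hd he cg gam_gt0.
by apply: card_eq_trans E (IHm _ _ cg'); apply: leq_trans lt_g _.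
Qed.
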